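(* (I) Let $\ell\in\mathbb{N}$. For every regular tetrahedron in $\mathrm{T}_\ell^0$ there exist odd integers $a,b,c,d$ with $d\ge 1$, $\gcd(a,b,c)=1$, $a^2+b^2+c^2=3d^2$ and $d\mid \ell$, an admissible pair $(r,s)$ for $(a,b,c,d)$, a pair $(m,n)\in\Omega(\ell/d)$, and a choice of sign $\epsilon\in\{+1,-1\}$, such that the four vertices of the tetrahedron are the origin $O$, $P$, $Q$ and $R_\epsilon$. Here $P=P(m,n)$ and $Q=Q(m,n)$ are the points of the parametrization given in the context, and $R_\epsilon$ is the fourth point given in the context with $k=\ell/d$. (II) Conversely, let $(a,b,c,d)$ be a primitive solution of $a^2+b^2+c^2=3d^2$, let $(r,s)$ be an admissible pair for $(a,b,c,d)$, let $k\in\mathbb{N}$ and let $(m,n)\in\Omega(k)$. Then: (a) if $k\equiv 0 \pmod 3$, the coordinates of $R_\epsilon$ are all integers for both choices $\epsilon=+1$ and $\epsilon=-1$; (b) if $k\not\equiv 0\pmod 3$, the coordinates of $R_\epsilon$ are all integers for exactly one of the two choices $\epsilon\in\{+1,-1\}$.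
   Context: $\mathbb{N}$ denotes the positive integers. For $\ell\in\mathbb{N}$, $\mathrm{T}_\ell^0$ is the set of regular tetrahedra in $\mathbb{R}^3$ whose vertices all lie in $\mathbb{Z}^3$, whose side lengths equal $\ell\sqrt2$, and which have the origin $O=(0,0,0)$ as a vertex. For $k\in\mathbb{N}$, $\Omega(k)=\{(m,n)\in\mathbb{Z}^2 : m^2-mn+n^2=k^2\}$. A primitive solution of $a^2+b^2+c^2=3d^2$ is a quadruple of integers $(a,b,c,d)$ with $d\ge 1$ satisfying this equation and $\gcd(a,b,c)=1$ (then $a,b,c,d$ are all odd). Parametrization. Given a primitive solution $(a,b,c,d)$, put $q=a^2+b^2$. For integers $r,s$ with $2q=s^2+3r^2$ define $$m_x=-\frac{db(3r+s)+ac(r-s)}{2q},\quad n_x=-\frac{rac+dbs}{q},$$ $$m_y=\frac{da(3r+s)-bc(r-s)}{2q},\quad n_y=\frac{das-bcr}{q},$$ $$m_z=\frac{r-s}{2},\quad n_z=r,$$ $$m_u=-\frac{rac+dbs}{q},\quad n_u=-\frac{db(s-3r)+ac(r+s)}{2q},$$ $$m_v=\frac{das-rbc}{q},\quad n_v=\frac{da(s-3r)-bc(r+s)}{2q},$$ $$m_w=r,\quad n_w=\frac{r+s}{2}.$$ The pair $(r,s)$ is called admissible for $(a,b,c,d)$ if $r,s\in\mathbb{Z}$, $2q=s^2+3r^2$, and all twelve numbers above are integers. For an admissible pair and $(m,n)\in\mathbb{Z}^2$ define $$P=P(m,n)=(m_um-n_un,\; m_vm-n_vn,\; m_wm-n_wn),$$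 $$Q=Q(m,n)=(m_xm-n_xn,\; m_ym-n_yn,\; m_zm-n_zn).$$ Fourth point. For $k\in\mathbb{N}$, $(m,n)\in\Omega(k)$ and $\epsilon\in\{+1,-1\}$ (the same sign in all three coordinates) define $$R_\epsilon=\left(\frac{(m_x+m_u)m-(n_x+n_u)n+2\epsilon ak}{3},\ \frac{(m_y+m_v)m-(n_y+n_v)n+2\epsilon bk}{3},\ \frac{(m_z+m_w)m-(n_z+n_w)n+2\epsilon ck}{3}\right).$$ *)

(* Defs.v *)
From HB Require Import structures.
From mathcomp Require Import all_boot all_order all_algebra.
From mathcomp Require Import finmap.
From mathcomp Require Import reals.

Set Implicit Arguments.
Unset Strict Implicit.
Unset Printing Implicit Defensive.

Import Order.TTheory GRing.Theory Num.Theory.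

Local Open Scope ring_scope.

Definition edist (R : realType) (p q : 'rV[R]_3) : R :=
  Num.sqrt (\sum_(i < 3) (p 0 i - q 0 i) ^+ 2).

(* A tetrahedron is identified with its set of vertices.  Four points at equal
   positive pairwise distances are never coplanar, so no separate
   nondegeneracy condition is needed when [0 < side]. *)
Definition regular_tetrahedron (R : realType) (side : R)
    (V : {fset 'rV[R]_3}) : Prop :=
  (#|` V|)%fset = 4%N /\
  (forall p q, p \in V -> q \in V -> p != q -> edist p q = side).

Definition integral_point (R : archiNumDomainType) (p : 'rV[R]_3) : Prop :=
  forall i, p 0 i \is a Num.int.

Definition T0 (R : realType) (l : nat) (V : {fset 'rV[R]_3}) : Prop :=
  [/\ regular_tetrahedron (l%:R * Num.sqrt 2) V,
      (forall p, p \in V -> integral_point p)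
    & 0 \in V].

Definition Omega (k m n : int) : Prop := m ^+ 2 - m * n + n ^+ 2 = k ^+ 2.

Definition oddz (a : int) : bool := ~~ (2 %| a)%Z.

Definition primitive_solution (a b c d : int) : Prop :=
  [/\ 1 <= d, a ^+ 2 + b ^+ 2 + c ^+ 2 = 3 * d ^+ 2 & gcdz (gcdz a b) c = 1].

Record coeffs := Coeffs {
  m_x : rat; n_x : rat; m_y : rat; n_y : rat; m_z : rat; n_z : rat;
  m_u : rat; n_u : rat; m_v : rat; n_v : rat; m_w : rat; n_w : rat }.

Definition coeffs_rat (a b c d r s : rat) : coeffs :=
  let q := a ^+ 2 + b ^+ 2 in
  {| m_x := - ((d * b * (3 * r + s) + a * c * (r - s)) / (2 * q));
     n_x := - ((r * a * c + d * b * s) / q);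
     m_y := (d * a * (3 * r + s) - b * c * (r - s)) / (2 * q);
     n_y := (d * a * s - b * c * r) / q;
     m_z := (r - s) / 2;
     n_z := r;
     m_u := - ((r * a * c + d * b * s) / q);
     n_u := - ((d * b * (s - 3 * r) + a * c * (r + s)) / (2 * q));
     m_v := (d * a * s - r * b * c) / q;
     n_v := (d * a * (s - 3 * r) - b * c * (r + s)) / (2 * q);
     m_w := r;
     n_w := (r + s) / 2 |}.

Definition coeffs_of (a b c d r s : int) : coeffs :=
  coeffs_rat a%:Q b%:Q c%:Q d%:Q r%:Q s%:Q.

Definition integral_coeffs (t : coeffs) : bool :=
  all (fun x : rat => x \is a Num.int)
    [:: m_x t; n_x t; m_y t; n_y t; m_z t; n_z t;
        m_u t; n_u t; m_v t; n_v t; m_w t; n_w t].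

Definition admissible (a b c d r s : int) : Prop :=
  2 * (a ^+ 2 + b ^+ 2) = s ^+ 2 + 3 * r ^+ 2 /\
  integral_coeffs (coeffs_of a b c d r s).

Definition point3 (x y z : rat) : 'rV[rat]_3 := \row_(i < 3) [:: x; y; z]`_i.

Definition pointP (a b c d r s m n : int) : 'rV[rat]_3 :=
  let t := coeffs_of a b c d r s in
  point3 (m_u t * m%:Q - n_u t * n%:Q)
         (m_v t * m%:Q - n_v t * n%:Q)
         (m_w t * m%:Q - n_w t * n%:Q).

Definition pointQ (a b c d r s m n : int) : 'rV[rat]_3 :=
  let t := coeffs_of a b c d r s in
  point3 (m_x t * m%:Q - n_x t * n%:Q)
         (m_y t * m%:Q - n_y t * n%:Q)
         (m_z t * m%:Q - n_z t * n%:Q).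

Definition is_sign (eps : int) : Prop := eps = 1 \/ eps = -1.

Definition pointR (a b c d r s k m n eps : int) : 'rV[rat]_3 :=
  let t := coeffs_of a b c d r s in
  point3
    (((m_x t + m_u t) * m%:Q - (n_x t + n_u t) * n%:Q
        + 2 * eps%:Q * a%:Q * k%:Q) / 3)
    (((m_y t + m_v t) * m%:Q - (n_y t + n_v t) * n%:Q
        + 2 * eps%:Q * b%:Q * k%:Q) / 3)
    (((m_z t + m_w t) * m%:Q - (n_z t + n_w t) * n%:Q
        + 2 * eps%:Q * c%:Q * k%:Q) / 3).

Definition to_space (R : realType) (p : 'rV[rat]_3) : 'rV[R]_3 :=
  map_mx ratr p.

(* Main.v *)
Require Import Defs.
From HB Require Import structures.
From mathcomp Require Import all_boot all_order all_algebra.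
From mathcomp Require Import finmap.
From mathcomp Require Import reals boolp.
From mathcomp Require Import zify ring lra.

(** Let N = (a, b, c), so that N.N = 3 d^2.  In the plane orthogonal to N the
    rotation by 60 degrees is v |-> (v + (N x v) / d) / 2.  The integral vectors
    of that plane whose rotated image v' is again integral form a module over
    the Eisenstein integers; membership is the relation [turns N d v v'],
    written without division as N x v = d (2 v' - v).

    The parametrization is this module in coordinates.  A pair (r, s) is
    admissible exactly when r = A_3 and s = (2 C - A)_3 for some vector A of
    the module, with rotated image C and A.A = 2 d^2; the twelve coefficients
    are then the entries of A - C, A and C ([admissible_turns],
    [turns_admissible]).  The points P = m A - n C and Q = m (A - C) - n A are
    an Eisenstein multiple of A and its rotation by -60 degrees, so their
    squared length is 2 d^2 (m^2 - m n + n^2).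

    For part (I), a face O, X, Y of the tetrahedron has normal Y x X = g N with
    N primitive and g d = l^2, and X is the rotated image of Y.  What has to be
    shown is that the whole module is generated by one vector A with
    A.A = 2 d^2.  A nonzero vector v of minimal length generates it, by
    Euclidean division ([turns_generator]).  Its length is then forced
    ([turns_generator_norm]): v.v = 2 d t where v x v' = t N, every cross
    product of two module vectors is a multiple of t N, and the module contains
    explicit vectors whose cross products are d (1 - 3 d^2 (u.u)) N and
    multiples of d^2 N, u being a Bezout vector with u.N = 1; hence t divides d.
    Since module vectors are parallel to N modulo d, also d divides t.  Finally
    3 Z - X - Y is orthogonal to the face, hence equal to e N with
    e d = 2 l or e d = - 2 l; as d is odd, it divides l, and Z is the fourth
    point.

    For part (II), P + Q is congruent modulo 3 to tau N with tau^2 = k^2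
    modulo 3 ([face_sum_mod3]), so R_eps is integral if and only if 3 divides
    tau + 2 eps k, that is, if and only if tau = eps k modulo 3. *)

Set Implicit Arguments.
Unset Strict Implicit.
Unset Printing Implicit Defensive.

Import Order.TTheory GRing.Theory Num.Theory.

Local Open Scope fset_scope.
Local Open Scope ring_scope.

(** * Three-dimensional vectors *)

Notation crd0 := (@Ordinal 3 0 isT).
Notation crd1 := (@Ordinal 3 1 isT).
Notation crd2 := (@Ordinal 3 2 isT).

Definition vec3 (R : Type) (x y z : R) : 'rV[R]_3 :=
  \row_i (if i == crd0 then x else if i == crd1 then y else z).

Definition dot (R : pzRingType) (u v : 'rV[R]_3) : R :=
  u 0 crd0 * v 0 crd0 + u 0 crd1 * v 0 crd1 + u 0 crd2 * v 0 crd2.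

Definition cross (R : pzRingType) (u v : 'rV[R]_3) : 'rV[R]_3 :=
  vec3 (u 0 crd1 * v 0 crd2 - u 0 crd2 * v 0 crd1)
       (u 0 crd2 * v 0 crd0 - u 0 crd0 * v 0 crd2)
       (u 0 crd0 * v 0 crd1 - u 0 crd1 * v 0 crd0).

Lemma forall_ord3 (P : 'I_3 -> Prop) :
  P crd0 -> P crd1 -> P crd2 -> forall i, P i.
Proof.
move=> P0 P1 P2 [[|[|[|//]]] lti]; [move: P0|move: P1|move: P2];
by congr P; apply: val_inj.
Qed.

Lemma row3P (R : Type) (u v : 'rV[R]_3) :
  u 0 crd0 = v 0 crd0 -> u 0 crd1 = v 0 crd1 -> u 0 crd2 = v 0 crd2 -> u = v.
Proof. by move=> h0 h1 h2; apply/rowP; apply: forall_ord3. Qed.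

Lemma vec30 (R : Type) (x y z : R) : vec3 x y z 0 crd0 = x.
Proof. by rewrite mxE. Qed.
Lemma vec31 (R : Type) (x y z : R) : vec3 x y z 0 crd1 = y.
Proof. by rewrite mxE. Qed.
Lemma vec32 (R : Type) (x y z : R) : vec3 x y z 0 crd2 = z.
Proof. by rewrite mxE. Qed.

Definition vec3E := (vec30, vec31, vec32).

Ltac coords :=
  try apply: row3P; rewrite /cross /dot; rewrite ?(vec3E, mxE) /=.

Lemma dotC (R : comNzRingType) (u v : 'rV[R]_3) : dot u v = dot v u.
Proof. by coords; ring. Qed.

Lemma dotDl (R : comNzRingType) (u v w : 'rV[R]_3) :
  dot (u + v) w = dot u w + dot v w.
Proof. by coords; ring. Qed.

Lemma dotNl (R : comNzRingType) (u w : 'rV[R]_3) : dot (- u) w = - dot u w.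
Proof. by coords; ring. Qed.

Lemma dotZl (R : comNzRingType) x (u w : 'rV[R]_3) :
  dot (x *: u) w = x * dot u w.
Proof. by coords; ring. Qed.

Lemma dotDr (R : comNzRingType) (u v w : 'rV[R]_3) :
  dot w (u + v) = dot w u + dot w v.
Proof. by coords; ring. Qed.

Lemma dotNr (R : comNzRingType) (u w : 'rV[R]_3) : dot w (- u) = - dot w u.
Proof. by coords; ring. Qed.

Lemma dotZr (R : comNzRingType) x (u w : 'rV[R]_3) :
  dot w (x *: u) = x * dot w u.
Proof. by coords; ring. Qed.

Definition dotE := (dotDl, dotNl, dotZl, dotDr, dotNr, dotZr).

Lemma dot_crossl (R : comNzRingType) (u v : 'rV[R]_3) : dot u (cross u v) = 0.
Proof. by coords; ring. Qed.

Lemma dot_crossr (R : comNzRingType) (u v : 'rV[R]_3) : dot v (cross u v) = 0.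
Proof. by coords; ring. Qed.

Lemma cross_cross (R : comNzRingType) (u v w : 'rV[R]_3) :
  cross u (cross v w) = dot u w *: v - dot u v *: w.
Proof. by coords; ring. Qed.

Lemma dot_cross_cross (R : comNzRingType) (u v : 'rV[R]_3) :
  dot (cross u v) (cross u v) = dot u u * dot v v - dot u v ^+ 2.
Proof. by coords; ring. Qed.

(** The Gram determinant of n, v, w is the square of their triple product; it
    factors when n is orthogonal to the other two. *)
Lemma gram (R : comNzRingType) (n v w : 'rV[R]_3) :
  dot n v = 0 -> dot n w = 0 ->
  dot n n * (dot v v * dot w w - dot v w ^+ 2) = dot w (cross n v) ^+ 2.
Proof.
move=> nv nw.
have -> : dot w (cross n v) ^+ 2 =
    dot n n * (dot v v * dot w w - dot v w ^+ 2)
    + dot n v * (dot v w * dot n w - dot n v * dot w w)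
    + dot n w * (dot n v * dot v w - dot v v * dot n w).
  by coords; ring.
by rewrite nv nw !mul0r !addr0.
Qed.

Lemma dot_ge0 (v : 'rV[int]_3) : 0 <= dot v v.
Proof. by rewrite /dot -!expr2 !addr_ge0 ?sqr_ge0. Qed.

Lemma dot_eq0 (v : 'rV[int]_3) : dot v v = 0 -> v = 0.
Proof.
move=> h; have {h} [h0 h1 h2] : [/\ v 0 crd0 = 0, v 0 crd1 = 0 & v 0 crd2 = 0].
  move: h; rewrite /dot -!expr2 => /eqP.
  rewrite !paddr_eq0 ?addr_ge0 ?sqr_ge0 // !sqrf_eq0.
  by case/andP=> /andP[/eqP-> /eqP->] /eqP->.
by apply: row3P; rewrite mxE.
Qed.

Lemma vscaleI (x : int) (u v : 'rV[int]_3) : x != 0 -> x *: u = x *: v -> u = v.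
Proof.
move=> x0 /rowP h; apply/rowP => i; have := h i; rewrite !mxE.
exact: mulfI.
Qed.

(** * The Eisenstein module of an integral plane *)

(** When N.N = 3 d^2 and d > 0, this says that v' is the image of v under the rotation
    by 60 degrees about N. *)
Definition turns (N : 'rV[int]_3) (d : int) (v v' : 'rV[int]_3) : Prop :=
  dot N v = 0 /\ cross N v = d *: (2 *: v' - v).

Implicit Types (N u v w A C : 'rV[int]_3) (a b c d : int).

Lemma turns_comb N d v v' w w' i j : turns N d v v' -> turns N d w w' ->
  turns N d (i *: v + j *: w) (i *: v' + j *: w').
Proof.
move=> [nv cv] [nw cw]; split; first by rewrite !dotE nv nw; ring.
have -> : cross N (i *: v + j *: w) = i *: cross N v + j *: cross N w.
  by coords; ring.
by rewrite cv cw; coords; ring.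
Qed.

(** Two successive rotations send v to v' - v: the rotation is a root of
    X^2 - X + 1. *)
Lemma turns_next N d v v' : d != 0 -> dot N N = 3 * d ^+ 2 ->
  turns N d v v' -> turns N d v' (v' - v).
Proof.
move=> d0 NN [nv cv].
have e : cross N (d *: (2 *: v' - v)) = - (3 * d ^+ 2) *: v.
  by rewrite -cv cross_cross nv NN; coords; ring.
split.
  have : d * (2 * dot N v' - dot N v) = 0.
    have := dot_crossl N v; rewrite cv !dotE; lra.
  by rewrite nv subr0 => /eqP; rewrite !mulf_eq0 (negbTE d0) /= => /eqP.
apply: (@vscaleI (2 * d)); first by rewrite mulf_neq0.
have -> : (2 * d) *: cross N v' =
    cross N (d *: (2 *: v' - v)) + d *: cross N v by coords; ring.
by rewrite e cv; coords; ring.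
Qed.

(** Multiplication by the Eisenstein integer i + j omega, omega being the
    rotation. *)
Lemma turns_span N d v v' i j : d != 0 -> dot N N = 3 * d ^+ 2 ->
  turns N d v v' -> turns N d (i *: v + j *: v') (i *: v' + j *: (v' - v)).
Proof. by move=> d0 NN h; apply: turns_comb => //; apply: turns_next. Qed.

Lemma turns_dot N d v v' : d != 0 -> turns N d v v' ->
  2 * dot v v' = dot v v.
Proof.
move=> d0 [nv cv]; have := dot_crossr N v; rewrite cv !dotE.
by move/eqP; rewrite mulf_eq0 (negbTE d0) /= => /eqP; lra.
Qed.

Lemma turns_norm N d v v' : d != 0 -> dot N N = 3 * d ^+ 2 ->
  turns N d v v' -> dot v' v' = dot v v.
Proof.
move=> d0 NN h; have e1 := turns_dot d0 h.
have e2 := turns_dot d0 (turns_next d0 NN h).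
move: e2; rewrite !dotE (dotC v' v) => e2; lra.
Qed.

Lemma turns_cross N d v v' : turns N d v v' ->
  (2 * d) *: cross v v' = dot v v *: N.
Proof.
move=> [nv cv].
have -> : (2 * d) *: cross v v' = cross v (d *: (2 *: v' - v)).
  by coords; ring.
by rewrite -cv cross_cross (dotC v N) nv; coords; ring.
Qed.

Lemma round_mul (x D : int) : 0 < D -> exists j : int, `|2 * (x - j * D)| <= D.
Proof.
move=> D0; exists ((2 * x + D) %/ (2 * D))%Z.
have D2 : 0 < 2 * D by lia.
have h1 := divz_eq (2 * x + D) (2 * D).
have h2 : 0 <= ((2 * x + D) %% (2 * D))%Z by rewrite modz_ge0; lia.
have h3 := ltz_pmod (2 * x + D) D2.
by rewrite ler_norml; apply/andP; split; lia.
Qed.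

(** In the orthogonal frame (v, tau) with tau = 2 v' - v, where
    tau.tau = 3 v.v, the coordinates of w are rounded successively: j makes the
    tau-coordinate of the remainder at most 1/4 in absolute value, then i makes
    its v-coordinate at most 1/2.  The remainder z then has
    z.z <= (1/4 + 3/16) v.v. *)
Lemma turns_euclid N d v v' w w' :
  d != 0 -> dot N N = 3 * d ^+ 2 -> v != 0 ->
  turns N d v v' -> turns N d w w' ->
  exists i j : int, let z := w - (i *: v + j *: v') in dot z z < dot v v.
Proof.
move=> d0 NN v0 hv hw.
have D0 : 0 < dot v v.
  by rewrite lt0r dot_ge0 andbT; apply: contra_neq v0; apply: dot_eq0.
have evv' := turns_dot d0 hv; have ev'v' := turns_norm d0 NN hv.
set D := dot v v in D0 evv' ev'v' *.
pose tau := 2 *: v' - v.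
have D3 : 0 < 3 * D by lia.
have [j hj] := round_mul (2 * dot w tau) D3.
have D2 : 0 < 2 * D by lia.
have [i hi] := round_mul (2 * dot w v - j * D) D2.
exists i, j; set z := w - _; cbv zeta.
have zv : 2 * dot z v = 2 * dot w v - j * D - i * (2 * D).
  by rewrite /z !dotE (dotC v' v) -/D -evv'; ring.
have ztau : 2 * dot z tau = 2 * dot w tau - j * (3 * D).
  by rewrite /z /tau !dotE (dotC v' v) -/D ev'v' -evv'; ring.
have [nv cv] := hv; have [nw _] := hw.
have nz : dot N z = 0.
  by rewrite /z !dotE nw nv (turns_next d0 NN hv).1; ring.
have G := gram nv nz; rewrite cv NN -/D -/tau dotZr in G.
have {}G : 3 * (D * dot z z) = 3 * dot z v ^+ 2 + dot z tau ^+ 2.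
  apply: (@mulfI _ (d ^+ 2)); first by rewrite sqrf_eq0.
  rewrite (_ : _ * (3 * _) = 3 * d ^+ 2 * (D * dot z z - dot v z ^+ 2)
                             + 3 * d ^+ 2 * dot v z ^+ 2); last by ring.
  by rewrite G (dotC v z); ring.
rewrite -zv in hi; rewrite -ztau in hj.
have h1 : (2 * (2 * dot z v)) ^+ 2 <= (2 * D) ^+ 2.
  by rewrite -[leLHS]real_normK ?num_real // ler_sqr ?nnegrE ?normr_ge0 //;
    exact: ltW.
have h2 : (2 * (2 * dot z tau)) ^+ 2 <= (3 * D) ^+ 2.
  by rewrite -[leLHS]real_normK ?num_real // ler_sqr ?nnegrE ?normr_ge0 //;
    exact: ltW.
have Dsq : 0 < D ^+ 2 by rewrite exprn_gt0.
rewrite -(ltr_pM2l D0) -expr2.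
move: G h1 h2 Dsq; rewrite !exprMn.
move: (D * _) (dot z v ^+ 2) (dot z tau ^+ 2) (D ^+ 2) => p x2 y2 D'; lra.
Qed.

(** A vector of minimal length generates the module; it is reached by
    infinite descent, a remainder of [turns_euclid] being a shorter vector as
    long as generation fails. *)
Lemma turns_generator N d w w' :
  d != 0 -> dot N N = 3 * d ^+ 2 -> turns N d w w' -> w != 0 ->
  exists v v', [/\ v != 0, turns N d v v' &
    forall x x', turns N d x x' -> exists i j, x = i *: v + j *: v'].
Proof.
move=> d0 NN; have [k] := ubnP `|dot w w|%N.
elim: k w w' => // k IHk v v' ltk hv v0.
have [gen|ngen] := pselect (forall x x', turns N d x x' ->
    exists i j, x = i *: v + j *: v'); first by exists v, v'.
have [x [x' [hx nx]]] : exists x x', turns N d x x' /\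
    ~ exists i j, x = i *: v + j *: v'.
  apply: contrapT => h; apply: ngen => x x' hx; apply: contrapT => nx.
  by apply: h; exists x, x'.
have [i [j /= lt]] := turns_euclid d0 NN v0 hv hx.
pose z := x - (i *: v + j *: v').
have hz : turns N d z (x' - (i *: v' + j *: (v' - v))).
  have := turns_comb 1 (-1) hx (turns_span i j d0 NN hv).
  by rewrite !scaleN1r !scale1r.
apply: (IHk z _ _ hz).
  have := dot_ge0 z; have := dot_ge0 v; rewrite -/z in lt; lia.
apply: contra_notN nx => /eqP/subr0_eq ->; by exists i, j.
Qed.

(** Once d divides N x v, the division by 2 in (v + (N x v) / d) / 2 comes for
    free.  Modulo 2, where N = (1, 1, 1), each coordinate of N x v is the sum of
    the two other coordinates of v, which is that coordinate of v because
    N.v = 0. *)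
Lemma turns_halve N d v w : oddz (N 0 crd0) -> oddz (N 0 crd1) ->
  oddz (N 0 crd2) -> oddz d ->
  dot N v = 0 -> cross N v = d *: w -> exists v', turns N d v v'.
Proof.
have odd_half (x : int) : oddz x -> exists y, x = 2 * y + 1.
  by rewrite /oddz => h; exists (x %/ 2)%Z; lia.
move=> /odd_half[a ea] /odd_half[b eb] /odd_half[c ec] /odd_half[e ed] nv cv.
suff [v' hv'] : exists v', v + w = 2 *: v'.
  exists v'; split=> //; rewrite cv -hv'; congr (_ *: _).
  by rewrite addrC addKr.
move: nv; rewrite /dot ea eb ec => nv.
have := congr1 (fun M : 'rV_3 => M 0 crd0) cv.
have := congr1 (fun M : 'rV_3 => M 0 crd1) cv.
have := congr1 (fun M : 'rV_3 => M 0 crd2) cv.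
rewrite /cross !vec3E !mxE ea eb ec ed.
set x := v 0 _ in nv *; set y := v 0 _ in nv *; set t := v 0 _ in nv *.
set wx := w 0 crd0; set wy := w 0 crd1; set wz := w 0 crd2 => e2 e1 e0.
(* Each equation for N x v = d w expresses a coordinate of w, as d = 2 e + 1;
   subtracting N.v = 0 makes all coefficients of v + w even. *)
exists (vec3 (b * t - c * y - e * wx - (a * x + b * y + c * t) - y)
             (c * x - a * t - e * wy - (a * x + b * y + c * t) - t)
             (a * y - b * x - e * wz - (a * x + b * y + c * t) - x)).
apply: row3P; rewrite !mxE /= -/wx -/wy -/wz -/x -/y -/t; lia.
Qed.

(** In terms of lattices, the module has index d in the integral points of the
    plane.  Instead of counting cosets, one shows that d and the factor t in
    v x v' = t N divide each other. *)
Lemma turns_generator_norm N u d v v' :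
  oddz (N 0 crd0) -> oddz (N 0 crd1) -> oddz (N 0 crd2) -> oddz d -> 0 < d ->
  dot N N = 3 * d ^+ 2 -> dot u N = 1 -> v != 0 -> turns N d v v' ->
  (forall x x', turns N d x x' -> exists i j, x = i *: v + j *: v') ->
  dot v v = 2 * d ^+ 2.
Proof.
move=> Na Nb Nc od d_gt0 NN uN v0 hv gen.
have d0 : d != 0 by rewrite gt_eqF.
have Nu : dot N u = 1 by rewrite dotC.
pose t := dot u (cross v v').
have Dt : dot v v = 2 * d * t.
  by rewrite /t -dotZr (turns_cross hv) dotZr uN mulr1.
(* All cross products in the module are multiples of t N. *)
have tdvd x w y z : dot N x = 0 -> cross N x = d *: w -> dot N y = 0 ->
    cross N y = d *: z -> (t %| dot u (cross x y))%Z.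
  move=> nx cx ny cy.
  have [x' /gen[i [j ->]]] := turns_halve Na Nb Nc od nx cx.
  have [y' /gen[k [l ->]]] := turns_halve Na Nb Nc od ny cy.
  apply/dvdzP; exists (i * l - j * k); rewrite /t; coords; ring.
(* N - 3 d^2 u is - 3 d^2 times the orthogonal projection of u on the plane; it
   is in the module since it is congruent to N modulo d, while N x u is only in
   the plane and has to be multiplied by d. *)
have t1 : (t %| d * (1 - 3 * d ^+ 2 * dot u u))%Z.
  have -> : d * (1 - 3 * d ^+ 2 * dot u u) =
      dot u (cross (N - (3 * d ^+ 2) *: u) (d *: cross N u)).
    have -> : cross (N - (3 * d ^+ 2) *: u) (d *: cross N u) =
      d *: (cross N (cross N u) - (3 * d ^+ 2) *: cross u (cross N u)).
      by coords; ring.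
    by rewrite !cross_cross !dotE Nu uN NN; ring.
  apply: (tdvd _ (- (3 * d) *: cross N u) _ (cross N (cross N u))).
  - by rewrite !dotE NN Nu; ring.
  - by coords; ring.
  - by rewrite dotE dot_crossl mulr0.
  - by coords; ring.
(* The vectors d (N x w) belong to the module whatever w is. *)
have t2 w z : (t %| d ^+ 2 * dot N (cross w z))%Z.
  have -> : d ^+ 2 * dot N (cross w z) =
      dot u (cross (d *: cross N w) (d *: cross N z)).
    have -> : cross (d *: cross N w) (d *: cross N z) =
      (d ^+ 2 * dot N (cross w z)) *: N by coords; ring.
    by rewrite dotZr uN mulr1.
  have h x : dot N (d *: cross N x) = 0 by rewrite dotE dot_crossl mulr0.
  apply: (tdvd _ (cross N (cross N w)) _ (cross N (cross N z)));
    rewrite ?h //; by coords; ring.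
have {}t2 : (t %| d ^+ 2)%Z.
  pose e0 := vec3 1 0 0 : 'rV[int]_3; pose e1 := vec3 0 1 0 : 'rV[int]_3.
  pose e2 := vec3 0 0 1 : 'rV[int]_3.
  have -> : d ^+ 2 = u 0 crd0 * (d ^+ 2 * dot N (cross e1 e2))
      + u 0 crd1 * (d ^+ 2 * dot N (cross e2 e0))
      + u 0 crd2 * (d ^+ 2 * dot N (cross e0 e1)).
    have -> : dot N (cross e1 e2) = N 0 crd0 by coords; ring.
    have -> : dot N (cross e2 e0) = N 0 crd1 by coords; ring.
    have -> : dot N (cross e0 e1) = N 0 crd2 by coords; ring.
    by rewrite -[LHS]mulr1 -uN /dot; ring.
  by do !apply: rpredD; apply: dvdz_mull; apply: t2.
have td : (t %| d)%Z.
  have -> : d = d * (1 - 3 * d ^+ 2 * dot u u) + 3 * d * dot u u * d ^+ 2.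
    by ring.
  by apply: rpredD => //; apply: dvdz_mull.
(* Modulo d the vector v is the multiple (u.v) N of N, and N x v' vanishes. *)
have dt : (d %| t)%Z.
  have ev : v = dot u v *: N - d *: cross u (2 *: v' - v).
    have -> : d *: cross u (2 *: v' - v) = cross u (d *: (2 *: v' - v)).
      by coords; ring.
    by rewrite -hv.2 cross_cross uN; coords; ring.
  have -> : t = d * (dot u v * dot u (2 *: (v' - v) - v')
                     - dot u (cross (cross u (2 *: v' - v)) v')).
    rewrite /t {1}ev; set p := cross u (_ - _).
    have -> : cross (dot u v *: N - d *: p) v' =
        dot u v *: cross N v' - d *: cross p v' by coords; ring.
    by rewrite (turns_next d0 NN hv).2 !dotE; ring.
  exact: dvdz_mulr.
have D0 : 0 < dot v v.
  by rewrite lt0r dot_ge0 andbT; apply: contra_neq v0; apply: dot_eq0.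
have t_gt0 : 0 < t by move: D0; rewrite Dt; nia.
suff td_eq : t = d by rewrite Dt td_eq; ring.
suff : `|t|%N == `|d|%N by lia.
by rewrite eqn_dvd; move: td dt; rewrite !dvdzE => -> ->.
Qed.

(** * Admissible pairs and module vectors *)

(** Here w is the third coordinate of (a, b, c) x (x, y, z); it is d s for a
    vector A of the module, which is why (r, s) determines A. *)
Lemma plane_solve (F : fieldType) (a b c x y z w : F) :
  a ^+ 2 + b ^+ 2 != 0 -> a * x + b * y + c * z = 0 -> a * y - b * x = w ->
  x = - ((z * a * c + b * w) / (a ^+ 2 + b ^+ 2)) /\
  y = (a * w - b * c * z) / (a ^+ 2 + b ^+ 2).
Proof.
move=> q0 e <-; have -> : b * c * z = b * (c * z) by ring.
have -> : z * a * c = a * (c * z) by ring.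
have -> : c * z = - (a * x + b * y).
  by apply/eqP; rewrite -addr_eq0 addrC e.
by split; field.
Qed.

Definition lattice_coeffs A C : coeffs :=
  let a i := (A 0 i)%:~R in let c i := (C 0 i)%:~R in
  let b i := (A 0 i - C 0 i)%:~R in
  Coeffs (b crd0) (a crd0) (b crd1) (a crd1) (b crd2) (a crd2)
         (a crd0) (c crd0) (a crd1) (c crd1) (a crd2) (c crd2).

Lemma turns_solve a b c d A C :
  a ^+ 2 + b ^+ 2 != 0 -> turns (vec3 a b c) d A C ->
  let q : rat := a%:~R ^+ 2 + b%:~R ^+ 2 in
  let s := ((2 *: C - A) 0 crd2)%:~R in
  let r := (A 0 crd2)%:~R in
  (A 0 crd0)%:~R = - ((r * a%:~R * c%:~R + b%:~R * (d%:~R * s)) / q) /\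
  (A 0 crd1)%:~R = (a%:~R * (d%:~R * s) - b%:~R * c%:~R * r) / q.
Proof.
move=> q0 [nv cv] q s r.
apply: plane_solve; rewrite /q /s /r.
- by rewrite -!rmorphXn -rmorphD /= intr_eq0.
- by rewrite -!rmorphM -!rmorphD /=; move: nv; rewrite /dot !vec3E => ->.
- rewrite -!rmorphM -rmorphB /=; congr (_%:~R).
  by have := congr1 (fun M : 'rV_3 => M 0 crd2) cv; rewrite /cross !vec3E mxE.
Qed.

(** Solving for A by [plane_solve] gives n_x, n_y, m_u, m_v; solving likewise
    for C, whose rotated image is C - A, gives n_u, n_v. *)
Lemma coeffs_of_turns a b c d A C :
  a ^+ 2 + b ^+ 2 != 0 -> d != 0 ->
  dot (vec3 a b c) (vec3 a b c) = 3 * d ^+ 2 ->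
  turns (vec3 a b c) d A C ->
  coeffs_of a b c d (A 0 crd2) ((2 *: C - A) 0 crd2) = lattice_coeffs A C.
Proof.
move=> q0 d0 NN hA.
have q0' : (a%:~R ^+ 2 + b%:~R ^+ 2 != 0 :> rat).
  by rewrite -!rmorphXn -rmorphD /= intr_eq0.
have [eA0 eA1] := turns_solve q0 hA.
have [eC0 eC1] := turns_solve q0 (turns_next d0 NN hA).
move: eA0 eA1 eC0 eC1 q0'.
rewrite /coeffs_of /coeffs_rat /lattice_coeffs !mxE.
rewrite !(rmorphD, rmorphN, rmorphM) /=.
move: (A 0 crd0) (A 0 crd1) (A 0 crd2) (C 0 crd0) (C 0 crd1) (C 0 crd2).
move=> a0 a1 a2 c0 c1 c2 -> -> -> -> q0'.
by congr Coeffs; field; rewrite ?q0'.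
Qed.

(** The equation N x A = d (2 C - A) holds for the coefficients read as
    rational numbers as soon as N.N = 3 d^2; the equation 2 q = s^2 + 3 r^2
    gives the length of A. *)
Lemma admissible_turns a b c d r s :
  a ^+ 2 + b ^+ 2 != 0 -> d != 0 ->
  dot (vec3 a b c) (vec3 a b c) = 3 * d ^+ 2 ->
  admissible a b c d r s ->
  exists A C, [/\ turns (vec3 a b c) d A C, dot A A = 2 * d ^+ 2
    & coeffs_of a b c d r s = lattice_coeffs A C].
Proof.
move=> q0 d0 dNN [eqrs].
have q0' : (a%:~R ^+ 2 + b%:~R ^+ 2 != 0 :> rat).
  by rewrite -!rmorphXn -rmorphD /= intr_eq0.
have {}NN : a%:~R ^+ 2 + b%:~R ^+ 2 + c%:~R ^+ 2 - 3 * d%:~R ^+ 2 = 0 :> rat.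
  move/(congr1 (intr : int -> rat)): dNN; rewrite /dot !vec3E -!expr2.
  by rewrite !(rmorphD, rmorphM, rmorphXn) /= => ->; rewrite subrr.
have {}eqrs :
    s%:~R ^+ 2 + 3 * r%:~R ^+ 2 - 2 * (a%:~R ^+ 2 + b%:~R ^+ 2) = 0 :> rat.
  apply/eqP; rewrite subr_eq0; apply/eqP.
  move/(congr1 (intr : int -> rat)): eqrs.
  by rewrite !(rmorphD, rmorphM, rmorphXn) /= => ->.
rewrite /integral_coeffs /=.
case/and5P=> _ /intrP[a0 ea0] _ /intrP[a1 ea1] /and5P[_ _ _ /intrP[c0 ec0]].
case/and5P=> _ /intrP[c1 ec1] _ /intrP[c2 ec2] _.
have ratI : injective (intr : int -> rat) by apply: intr_inj.
exists (vec3 a0 a1 r), (vec3 c0 c1 c2).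
have hA : turns (vec3 a b c) d (vec3 a0 a1 r) (vec3 c0 c1 c2).
  split.
    apply: ratI; rewrite /dot !vec3E !(rmorphD, rmorphM) /= -ea0 -ea1.
    by field.
  apply: row3P; rewrite /cross !vec3E !mxE; apply: ratI;
    rewrite !(rmorphB, rmorphD, rmorphN, rmorphM) /=;
    rewrite -?ea0 -?ea1 -?ec0 -?ec1 -?ec2;
    apply/eqP; rewrite -subr_eq0; apply/eqP.
  - transitivity (b%:~R * r%:~R
        * (a%:~R ^+ 2 + b%:~R ^+ 2 + c%:~R ^+ 2 - 3 * d%:~R ^+ 2)
        / (a%:~R ^+ 2 + b%:~R ^+ 2) : rat).
      by field.
    by rewrite NN mulr0 mul0r.
  - transitivity (- a%:~R * r%:~R
        * (a%:~R ^+ 2 + b%:~R ^+ 2 + c%:~R ^+ 2 - 3 * d%:~R ^+ 2)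
        / (a%:~R ^+ 2 + b%:~R ^+ 2) : rat).
      by field.
    by rewrite NN mulr0 mul0r.
  - by field.
split=> //.
  apply: ratI; rewrite /dot !vec3E.
  rewrite !(rmorphB, rmorphD, rmorphN, rmorphM) /= -?ea0 -?ea1.
  apply/eqP; rewrite -subr_eq0; apply/eqP.
  transitivity ((r%:~R ^+ 2
      * (a%:~R ^+ 2 + b%:~R ^+ 2 + c%:~R ^+ 2 - 3 * d%:~R ^+ 2)
    + d%:~R ^+ 2
      * (s%:~R ^+ 2 + 3 * r%:~R ^+ 2 - 2 * (a%:~R ^+ 2 + b%:~R ^+ 2)))
    / (a%:~R ^+ 2 + b%:~R ^+ 2) : rat); first by field.
  by rewrite NN eqrs !mulr0 addr0 mul0r.
have es : s = (2 *: vec3 c0 c1 c2 - vec3 a0 a1 r) 0 crd2.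
  apply: ratI; rewrite !mxE /= !(rmorphB, rmorphN, rmorphD, rmorphM) /= -ec2.
  by field.
have er : r = (vec3 a0 a1 r) 0 crd2 by rewrite vec32.
rewrite {1}er es; exact: coeffs_of_turns.
Qed.

Lemma turns_admissible a b c d A C :
  a ^+ 2 + b ^+ 2 != 0 -> d != 0 ->
  dot (vec3 a b c) (vec3 a b c) = 3 * d ^+ 2 ->
  turns (vec3 a b c) d A C -> dot A A = 2 * d ^+ 2 ->
  admissible a b c d (A 0 crd2) ((2 *: C - A) 0 crd2).
Proof.
move=> q0 d0 NN hA AA; split; last first.
  by rewrite coeffs_of_turns //= /integral_coeffs /= !intr_int.
have : d ^+ 2 * (2 * (a ^+ 2 + b ^+ 2)) =
   d ^+ 2 * ((2 *: C - A) 0 crd2 ^+ 2 + 3 * A 0 crd2 ^+ 2).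
  have [nA cA] := hA.
  have h2 : d * (2 *: C - A) 0 crd2 = a * A 0 crd1 - b * A 0 crd0.
    by have := congr1 (fun M : 'rV_3 => M 0 crd2) cA; rewrite /cross !vec3E mxE.
  transitivity ((a ^+ 2 + b ^+ 2) * dot A A); first by rewrite AA; ring.
  transitivity ((d * (2 *: C - A) 0 crd2) ^+ 2
                + 3 * d ^+ 2 * A 0 crd2 ^+ 2); last by ring.
  rewrite h2 -NN; apply/eqP; rewrite -subr_eq0; apply/eqP.
  transitivity (dot (vec3 a b c) A
      * (a * A 0 crd0 + b * A 0 crd1 - c * A 0 crd2)).
    by rewrite /dot !vec3E; ring.
  by rewrite nA mul0r.
by move/mulfI; apply; rewrite sqrf_eq0.
Qed.

Lemma pointP_turns a b c d r s m n A C :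
  coeffs_of a b c d r s = lattice_coeffs A C ->
  pointP a b c d r s m n = map_mx intr (m *: A - n *: C).
Proof.
move=> e; rewrite /pointP e; apply: row3P; rewrite !mxE /=;
  rewrite !(rmorphD, rmorphN, rmorphM) /=; ring.
Qed.

Lemma pointQ_turns a b c d r s m n A C :
  coeffs_of a b c d r s = lattice_coeffs A C ->
  pointQ a b c d r s m n = map_mx intr (m *: (A - C) - n *: A).
Proof.
move=> e; rewrite /pointQ e; apply: row3P; rewrite !mxE /=;
  rewrite !(rmorphD, rmorphN, rmorphM) /=; ring.
Qed.

Lemma pointR_turns a b c d r s k m n eps A C :
  coeffs_of a b c d r s = lattice_coeffs A C ->
  pointR a b c d r s k m n eps =
  3^-1 *: map_mx intr ((m *: A - n *: C) + (m *: (A - C) - n *: A)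
                       + (2 * eps * k) *: vec3 a b c).
Proof.
move=> e; rewrite /pointR e; apply: row3P; rewrite !mxE /=;
  rewrite !(rmorphD, rmorphN, rmorphM) /=; by field.
Qed.

(** * Integrality of the fourth point *)

(** For T = v' + v one has N x T = 3 d (v' - v), so T is parallel to N modulo 3;
    comparing T.T = 6 d^2 k^2 with the decomposition determines tau^2. *)
Lemma face_sum_mod3 N u d (k : int) v v' :
  d != 0 -> dot N N = 3 * d ^+ 2 -> dot u N = 1 ->
  turns N d v v' -> dot v v = 2 * d ^+ 2 * k ^+ 2 ->
  exists tau S, v' + v = tau *: N + 3 *: S /\ (3 %| tau ^+ 2 - k ^+ 2)%Z.
Proof.
move=> d0 NN uN hv vv; have hv' := turns_next d0 NN hv.
have [nv cv] := hv; have [nv' cv'] := hv'.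
pose T := v' + v; pose S := - cross u (v' - v).
have TE : T = dot u T *: N + (3 * d) *: S.
  have : cross u (cross N T) = (3 * d) *: - S.
    have -> : cross N T = (3 * d) *: (v' - v).
      have -> : cross N T = cross N v' + cross N v by rewrite /T; coords; ring.
      by rewrite cv cv'; coords; ring.
    by rewrite /S; coords; ring.
  rewrite cross_cross uN scale1r scalerN => h.
  by rewrite -[(3 * d) *: S]opprK -h opprB addrC subrK.
exists (dot u T), (d *: S); split; first by rewrite scalerA -TE.
set tau := dot u T in TE *.
have TT : dot T T = 6 * d ^+ 2 * k ^+ 2.
  have := turns_norm d0 NN hv; have := turns_dot d0 hv.
  by rewrite /T !dotE (dotC v' v); lra.
have NT : dot N T = 0 by rewrite /T dotE nv nv'.
clearbody tau S T.
have NS : dot N S = - (d * tau).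
  apply: (@mulfI _ (3 * d)); first by rewrite mulf_neq0.
  by move: NT; rewrite TE !dotE NN; lra.
have : d ^+ 2 * 3 * (tau ^+ 2 - k ^+ 2) =
       d ^+ 2 * 3 * (3 * (dot S S - k ^+ 2)).
  move: TT; rewrite TE !dotE (dotC S N) NN NS; lra.
move/mulfI => ->; first by rewrite dvdz_mulr.
by rewrite mulf_neq0 // sqrf_eq0.
Qed.

Lemma third_integral (x : int) :
  ((3^-1 * x%:~R : rat) \is a Num.int) = (3 %| x)%Z.
Proof.
apply/idP/idP => [/intrP[y e]|/dvdzP[y ->]].
  by apply/dvdzP; exists y; apply: (@intr_inj rat);
    rewrite rmorphM /= -e; field.
by apply/intrP; exists y; rewrite rmorphM /=; field.
Qed.

Lemma third_point_integral N u (tau e : int) (S : 'rV[int]_3) : dot u N = 1 ->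
  integral_point (3^-1 *: map_mx intr (tau *: N + 3 *: S + e *: N) : 'rV[rat]_3)
  <-> (3 %| tau + e)%Z.
Proof.
move=> uN.
have E i : (tau *: N + 3 *: S + e *: N) 0 i = (tau + e) * N 0 i + 3 * S 0 i.
  by rewrite !mxE; ring.
have EI i : ((3^-1 *: map_mx intr (tau *: N + 3 *: S + e *: N) : 'rV[rat]_3) 0 i
    \is a Num.int) = (3 %| (tau + e) * N 0%R i)%Z.
  rewrite mxE [map_mx _ _ _ _]mxE third_integral E.
  by apply: rpredDr; rewrite dvdz_mulr.
split=> [h|h i]; last by rewrite EI dvdz_mulr.
have {EI}h i : (3 %| (tau + e) * N 0%R i)%Z by rewrite -EI; apply: h.
have -> : tau + e = u 0 crd0 * ((tau + e) * N 0 crd0)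
   + u 0 crd1 * ((tau + e) * N 0 crd1) + u 0 crd2 * ((tau + e) * N 0 crd2).
  by rewrite -[LHS]mulr1 -uN /dot; ring.
by do !apply: rpredD; apply: dvdz_mull.
Qed.

Lemma primitive_bezout a b c : gcdz (gcdz a b) c = 1 ->
  exists u, dot u (vec3 a b c) = 1.
Proof.
move=> g; have [x [y e]] := Bezoutz a b.
have [p [q]] := Bezoutz (gcdz a b) c; rewrite g -e => e'.
exists (vec3 (p * x) (p * y) q); rewrite /dot !vec3E -e'; ring.
Qed.

(** Q is (m - n) A - m C, the multiple of A by the Eisenstein integer
    (m - n) - m omega, whose norm is m^2 - m n + n^2. *)
Lemma omega_norm N d A C (m n : int) : d != 0 -> dot N N = 3 * d ^+ 2 ->
  turns N d A C -> dot A A = 2 * d ^+ 2 ->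
  let v := m *: (A - C) - n *: A in
  [/\ turns N d v (m *: A - n *: C) &
      dot v v = 2 * d ^+ 2 * (m ^+ 2 - m * n + n ^+ 2)].
Proof.
move=> d0 NN hA AA v; split.
  have := turns_span (m - n) (- m) d0 NN hA.
  have -> : (m - n) *: A + (- m) *: C = v by rewrite /v; coords; ring.
  by have -> : (m - n) *: C + (- m) *: (C - A) = m *: A - n *: C
    by coords; ring.
have AC := turns_dot d0 hA; have CC := turns_norm d0 NN hA.
rewrite /v !dotE (dotC C A) CC.
have -> : dot A C = d ^+ 2 by lia.
rewrite AA; ring.
Qed.

Lemma primitive_q a b c d : primitive_solution a b c d -> a ^+ 2 + b ^+ 2 != 0.
Proof.
case=> d1 e g; apply/negP; rewrite paddr_eq0 ?sqr_ge0 // !sqrf_eq0.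
case/andP=> /eqP a0 /eqP b0; move: g; rewrite a0 b0 gcd0z => g.
have c1 : c ^+ 2 = 1 by move: g; rewrite /gcdz /= => g; nia.
by move: e; rewrite a0 b0 c1; nia.
Qed.

Lemma pointR_integral_mod3 a b c d r s :
  primitive_solution a b c d -> admissible a b c d r s ->
  forall k m n : int, Omega k m n ->
  exists2 tau : int, (3 %| tau ^+ 2 - k ^+ 2)%Z &
    forall eps, integral_point (pointR a b c d r s k m n eps) <->
       (3 %| tau + 2 * eps * k)%Z.
Proof.
move=> prim adm k m n om.
have q0 := primitive_q prim; have [d1 NN g] := prim.
have d0 : d != 0 by lia.
have {}NN : dot (vec3 a b c) (vec3 a b c) = 3 * d ^+ 2.
  by rewrite -NN /dot !vec3E; ring.
have [A [C [hA AA eAC]]] := admissible_turns q0 d0 NN adm.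
have [u uN] := primitive_bezout g.
have [hv vv] := omega_norm m n d0 NN hA AA.
rewrite om in vv.
have [tau [S [eS tk]]] := face_sum_mod3 d0 NN uN hv vv.
exists tau => // eps.
by rewrite (pointR_turns k m n eps eAC) eS; apply: third_point_integral uN.
Qed.

(** * From a tetrahedron to its parameters *)

(** This holds because 3 is squarefree. *)
Lemma sqr_dvd_3sqr (g x : int) : 0 < g -> 0 < x ->
  (g ^+ 2 %| 3 * x ^+ 2)%Z -> (g %| x)%Z.
Proof.
move=> g0 x0; rewrite !dvdzE abszM !abszX.
have {}g0 : (0 < `|g|)%N by lia.
move: (absz g) (absz x) g0 => {g}g {x0}x g0.
set h := gcdn g x.
have h0 : (0 < h)%N by rewrite gcdn_gt0 g0.
have [/divnK eg /divnK ex] : (h %| g)%N /\ (h %| x)%N.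
  by rewrite dvdn_gcdl dvdn_gcdr.
rewrite -{1}eg -{1}ex !expnMn mulnA dvdn_pmul2r ?expn_gt0 ?h0 //.
have cop : coprime (g %/ h) (x %/ h).
  rewrite /coprime -(eqn_pmul2r h0) muln_gcdl eg ex mul1n.
  exact: eqxx.
rewrite Gauss_dvdl ?coprimeXl ?coprimeXr // => /dvdn_leq -/(_ isT) le3.
have gh : (g %/ h <= 1)%N by nia.
have : (0 < g %/ h)%N by rewrite divn_gt0 // dvdn_leq // dvdn_gcdl.
by move=> gh'; rewrite -eg (_ : g %/ h = 1)%N ?mul1n ?dvdn_gcdr //; lia.
Qed.

(** Squares modulo 4: if d is even then so are a, b and c, against
    primitivity; if d is odd then a^2 + b^2 + c^2 = 3 modulo 4,
    which takes three odd squares. *)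
Lemma primitive_odd a b c d : primitive_solution a b c d ->
  [/\ oddz a, oddz b, oddz c & oddz d].
Proof.
case=> d1 e g.
have nall : ~~ [&& (2 %| a)%Z, (2 %| b)%Z & (2 %| c)%Z].
  apply/negP => /and3P[ha hb hc].
  have : (2 %| gcdz (gcdz a b) c)%Z by rewrite !dvdz_gcd ha hb hc.
  by rewrite g.
have half (x : int) : exists y z, [/\ x ^+ 2 = 4 * y + z,
     (2 %| x)%Z -> z = 0 & ~~ (2 %| x)%Z -> z = 1].
  have ex := divz_eq x 2; case: (boolP (2 %| x)%Z) => hx.
    exists ((x %/ 2)%Z ^+ 2), 0; split => //.
    by rewrite {1}ex (_ : (x %% 2)%Z = 0); [ring | lia].
  exists ((x %/ 2)%Z ^+ 2 + (x %/ 2)%Z), 1; split => //.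
  by rewrite {1}ex (_ : (x %% 2)%Z = 1); [ring | lia].
have [xa [ya [ea ea0 ea1]]] := half a; have [xb [yb [eb eb0 eb1]]] := half b.
have [xc [yc [ec ec0 ec1]]] := half c; have [xd [yd [ed ed0 ed1]]] := half d.
move: nall; rewrite ea eb ec ed in e; rewrite /oddz.
case: (boolP (2 %| a)%Z) ea0 ea1 => ? ea0 ea1;
case: (boolP (2 %| b)%Z) eb0 eb1 => ? eb0 eb1;
case: (boolP (2 %| c)%Z) ec0 ec1 => ? ec0 ec1;
case: (boolP (2 %| d)%Z) ed0 ed1 => ? ed0 ed1 //= _; exfalso;
have := (ea0, ea1, eb0, eb1, ec0, ec1, ed0, ed1); lia.
Qed.

(** The primitive normal N is Y x X divided by its content g.  Since
    |Y x X|^2 = 3 l^4, one has g^2 | 3 l^4, hence g | l^2 and d = l^2 / g. *)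
Lemma face_normal (X Y : 'rV[int]_3) (l : int) : 0 < l ->
  dot X X = 2 * l ^+ 2 -> dot Y Y = 2 * l ^+ 2 -> dot X Y = l ^+ 2 ->
  exists a b c d g, [/\ primitive_solution a b c d, 0 < g, g * d = l ^+ 2,
    cross Y X = g *: vec3 a b c & turns (vec3 a b c) d Y X].
Proof.
move=> l0 XX YY XY; set M := cross Y X.
have MM : dot M M = 3 * l ^+ 2 * l ^+ 2.
  by rewrite /M dot_cross_cross XX YY dotC XY; ring.
pose g := gcdz (gcdz (M 0 crd0) (M 0 crd1)) (M 0 crd2).
have [ga gb gc] : [/\ (g %| M 0%R crd0)%Z, (g %| M 0%R crd1)%Z
    & (g %| M 0%R crd2)%Z].
  split; [| | exact: dvdz_gcdr];
    by apply: (dvdz_trans (dvdz_gcdl _ _)); rewrite ?dvdz_gcdl ?dvdz_gcdr.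
have [/dvdzP[a ea] /dvdzP[b eb] /dvdzP[c ec]] := And3 ga gb gc.
have EM : M = g *: vec3 a b c.
  by apply: row3P; rewrite [RHS]mxE vec3E mulrC.
have g0 : 0 < g.
  have : 0 <= g by rewrite /g /gcdz.
  rewrite le_eqVlt => /predU1P[g0|//].
  have : dot M M = 0 by rewrite EM -g0 scale0r /dot !mxE; ring.
  by rewrite MM; nia.
have NN : g ^+ 2 * (a ^+ 2 + b ^+ 2 + c ^+ 2) = 3 * l ^+ 2 * l ^+ 2.
  by rewrite -MM EM /dot !mxE /=; ring.
have l2 : 0 < l ^+ 2 by rewrite exprn_gt0.
have /dvdzP[d ed] : (g %| l ^+ 2)%Z.
  apply: sqr_dvd_3sqr => //; apply/dvdzP; exists (a ^+ 2 + b ^+ 2 + c ^+ 2).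
  by rewrite [RHS]mulrC NN; ring.
have gcd1 : gcdz (gcdz a b) c = 1.
  have : g = gcdz (gcdz a b) c * g.
    have {1}-> : g = gcdz (gcdz (a * g) (b * g)) (c * g) by rewrite -ea -eb -ec.
    have ng : g = `|g| by rewrite gtr0_norm.
    by rewrite ng -!mulz_gcdl -ng.
  by rewrite -{1}[g]mul1r => /mulIf <- //; rewrite gt_eqF.
exists a, b, c, d, g; split=> //; last first.
- split.
    have : dot M Y = 0 by rewrite /M dotC dot_crossl.
    by rewrite EM dotZl => /eqP; rewrite mulf_eq0 gt_eqF //= => /eqP.
  apply: (@vscaleI g); first by rewrite gt_eqF.
  have -> : g *: cross (vec3 a b c) Y = - cross Y M by rewrite EM; coords; ring.
  rewrite /M cross_cross YY dotC XY scalerA (mulrC g) -ed.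
  by coords; ring.
- by rewrite mulrC.
split=> //.
- have : 0 < d * g by rewrite -ed.
  by rewrite pmulr_lgt0 // => ?; lia.
apply: (@mulfI _ (g ^+ 2)); first by rewrite expf_neq0 // gt_eqF.
by rewrite NN ed; ring.
Qed.

(** If Y = i A + j C then X = i C + j (C - A), which are Q and P for m = - j and
    n = - (i + j). *)
Lemma tetrahedron_parametrized (l : nat) (X Y Z : 'rV[int]_3) : (0 < l)%N ->
  dot X X = 2 * l%:Z ^+ 2 -> dot Y Y = 2 * l%:Z ^+ 2 ->
  dot Z Z = 2 * l%:Z ^+ 2 -> dot X Y = l%:Z ^+ 2 ->
  dot X Z = l%:Z ^+ 2 -> dot Y Z = l%:Z ^+ 2 ->
  exists a b c d, [/\ oddz a, oddz b, oddz c & oddz d] /\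
    primitive_solution a b c d /\ (d %| l%:Z)%Z /\
    exists r s m n eps : int,
      let k := (l%:Z %/ d)%Z in
      [/\ admissible a b c d r s /\ Omega k m n, is_sign eps,
          pointP a b c d r s m n = map_mx intr X,
          pointQ a b c d r s m n = map_mx intr Y
        & pointR a b c d r s k m n eps = map_mx intr Z].
Proof.
move=> l0 XX YY ZZ XY XZ YZ.
have lz : 0 < l%:Z by lia.
have [a [b [c [d [g [prim g0 gd cYX hY]]]]]] := face_normal lz XX YY XY.
exists a, b, c, d; have [oa ob oc od] := primitive_odd prim.
split=> //; split=> //.
have q0 := primitive_q prim; have [d1 NN gcd1] := prim.
have d0 : d != 0 by lia.
set N := vec3 a b c in cYX hY.
have {}NN : dot N N = 3 * d ^+ 2 by rewrite -NN /dot !vec3E; ring.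
have [u uN] := primitive_bezout gcd1; rewrite -/N in uN.
have Y0 : Y != 0.
  apply: contraTneq lz => Y0; have : dot Y Y = 0 by rewrite Y0 /dot !mxE; ring.
  by rewrite YY; nia.
(* The vector W, orthogonal to X and Y, is parallel to N. *)
pose W := 3 *: Z - (X + Y).
have [e eW] : exists e, W = e *: N.
  exists (dot u W).
  have NW : cross N W = 0.
    apply: (@vscaleI g); first by rewrite gt_eqF.
    have -> : g *: cross N W = - cross W (g *: N) by coords; ring.
    rewrite -cYX cross_cross /W !dotE (dotC Y X) (dotC Z X) (dotC Z Y).
    rewrite XX YY XY XZ YZ; coords; ring.
  have := cross_cross u N W; rewrite NW uN scale1r => /esym/eqP.
  rewrite (_ : cross u 0 = 0) ?subr_eq0 => [/eqP //|].
  by coords; ring.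
have WW : (e * d) ^+ 2 = (2 * l%:Z) ^+ 2.
  apply: (@mulfI _ 3) => //.
  have <- : dot W W = 3 * (e * d) ^+ 2 by rewrite eW !dotE NN; ring.
  rewrite /W !dotE (dotC Y X) (dotC Z X) (dotC Z Y) XX YY ZZ XY XZ YZ; ring.
have [eps [seps ed]] : exists eps : int, is_sign eps /\ e * d = 2 * eps * l%:Z.
  move/eqP: WW; rewrite eqf_sqr => /orP[] /eqP ->.
    by exists 1; split; [left | ring].
  by exists (-1); split; [right | ring].
have dl : (d %| l%:Z)%Z.
  have : (d %| 2 * l%:Z)%Z.
    apply/dvdzP; case: seps ed => -> ed; [exists e | exists (- e)]; lia.
  rewrite Gauss_dvdzr //; move: od; rewrite /oddz coprimez_sym !dvdzE.
  by rewrite coprimezE prime_coprime.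
split=> //; have dk := divzK dl; set k := (l%:Z %/ d)%Z in dk *.
have [v [v' [v0 hv gen]]] := turns_generator d0 NN hY Y0.
have d_gt0 : 0 < d by lia.
have vv : dot v v = 2 * d ^+ 2.
  by apply: (turns_generator_norm _ _ _ od d_gt0 NN uN v0 hv gen);
    rewrite vec3E.
have [i [j eY]] := gen _ _ hY.
have eX : X = i *: v' + j *: (v' - v).
  have h2 := turns_span i j d0 NN hv; rewrite -eY in h2.
  apply: (@vscaleI (2 * d)); first by rewrite mulf_neq0.
  have E (x y : 'rV[int]_3) : (2 * d) *: x = d *: (2 *: x - y) + d *: y.
    by coords; ring.
  by rewrite (E _ Y) -hY.2 h2.2 -E.
exists (v 0 crd2), ((2 *: v' - v) 0 crd2), (- j), (- (i + j)), eps; cbv zeta.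
have coefE := coeffs_of_turns q0 d0 NN hv.
have PX : (- j) *: v - (- (i + j)) *: v' = X by rewrite eX; coords; ring.
have QY : (- j) *: (v - v') - (- (i + j)) *: v = Y by rewrite eY; coords; ring.
have [_ nY] := omega_norm (- j) (- (i + j)) d0 NN hv vv.
split=> //.
- split; first exact: turns_admissible.
  apply: (@mulfI _ (2 * d ^+ 2)); first by rewrite mulf_neq0 // sqrf_eq0.
  by rewrite -nY QY YY -dk; ring.
- by rewrite (pointP_turns _ _ coefE) PX.
- by rewrite (pointQ_turns _ _ coefE) QY.
rewrite (pointR_turns _ _ _ _ coefE) PX QY -/N.
have -> : 2 * eps * k = e.
  by apply: (@mulIf _ d) => //; rewrite ed -dk mulrA.
rewrite -eW /W addrC subrK; apply/rowP => t; rewrite !mxE rmorphM /=; by field.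
Qed.

(** * Real points and the theorem *)

Lemma dot_map (R : comNzRingType) (x y : 'rV[int]_3) :
  dot (map_mx (intr : int -> R) x) (map_mx intr y) = (dot x y)%:~R.
Proof. by rewrite /dot !mxE !rmorphD !rmorphM. Qed.

Lemma edist_sqr (R : realType) (p q : 'rV[R]_3) :
  edist p q ^+ 2 = dot (p - q) (p - q).
Proof.
rewrite /edist sqr_sqrtr; last by apply: sumr_ge0 => i _; apply: sqr_ge0.
rewrite !big_ord_recl big_ord0 addr0 addrA /dot !mxE -!expr2.
by congr (_ ^+ 2 + _ ^+ 2 + _ ^+ 2); congr (p 0 _ - q 0 _); apply: val_inj.
Qed.

Lemma dot_of_sides (x y : 'rV[int]_3) (h : int) :
  dot x x = 2 * h -> dot y y = 2 * h -> dot (x - y) (x - y) = 2 * h ->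
  dot x y = h.
Proof. by rewrite !dotE (dotC y x); lra. Qed.

Lemma integral_pointP (R : realType) (p : 'rV[R]_3) : integral_point p ->
  exists x : 'rV[int]_3, p = map_mx intr x.
Proof.
move=> h; exists (\row_i Num.floor (p 0 i)); apply/rowP => i.
by rewrite !mxE; apply/esym; rewrite floorK.
Qed.

Lemma fset4 (T : choiceType) (V : {fset T}) (o : T) : o \in V ->
  #|` V| = 4%N -> exists p q r, V = [fset o; p; q; r] /\
  [/\ o != p, o != q, o != r & [/\ p != q, p != r & q != r]].
Proof.
move=> oV c4; have := cardfsD1 o V; rewrite oV c4 => -[]; rewrite add0n => c3.
have /fset0Pn[p pV] : V `\ o != fset0 by rewrite -cardfs_gt0 -c3.
have := cardfsD1 p (V `\ o); rewrite pV -c3 => -[]; rewrite add0n => c2.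
have /fset0Pn[q qV] : V `\ o `\ p != fset0 by rewrite -cardfs_gt0 -c2.
have := cardfsD1 q (V `\ o `\ p); rewrite qV -c2 => -[]; rewrite add0n => c1.
have /eqP/cardfs1P[r er] : #|` V `\ o `\ p `\ q| = 1%N by rewrite -c1.
have rV : r \in V `\ o `\ p `\ q by rewrite er inE.
exists p, q, r; split.
  rewrite -(fsetD1K oV) -(fsetD1K pV) -(fsetD1K qV) er.
  by rewrite !fsetUA.
move: pV qV rV; rewrite !inE => /andP[po _] /and3P[qp qo _].
move=> /and4P[rq rp ro _]; by do 2?split; rewrite eq_sym.
Qed.

Lemma to_space_int (R : realType) (x : 'rV[int]_3) :
  to_space R (map_mx intr x) = map_mx intr x.
Proof. by apply/rowP => i; rewrite !mxE ratr_int. Qed.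

Theorem theorem2p2 (R : realType) :
  (forall l : nat, (0 < l)%N ->
     forall V : {fset 'rV[R]_3}, T0 l V ->
     exists a b c d : int,
       [/\ oddz a, oddz b, oddz c & oddz d] /\
       primitive_solution a b c d /\
       (d %| l%:Z)%Z /\
       exists r s m n eps : int,
         let k := (l%:Z %/ d)%Z in
         [/\ admissible a b c d r s,
             Omega k m n,
             is_sign eps
           & V = [fset 0;
                       to_space R (pointP a b c d r s m n);
                       to_space R (pointQ a b c d r s m n);
                       to_space R (pointR a b c d r s k m n eps)]])
  /\
  (forall a b c d r s : int,
     primitive_solution a b c d ->
     admissible a b c d r s ->
     forall k : nat, (0 < k)%N ->
     forall m n : int, Omega k%:Z m n ->
       ((3 %| k)%N ->
          forall eps : int, is_sign eps ->
            integral_point (pointR a b c d r s k%:Z m n eps)) /\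
       (~~ (3 %| k)%N ->
          exists! eps : int,
            is_sign eps /\
            integral_point (pointR a b c d r s k%:Z m n eps))).
Proof.
split.
- move=> l l0 V [[c4 side] intV V0].
  have [p [q [r [eV [op oq or_ [pq pr qr]]]]]] := fset4 V0 c4.
  have [pV qV rV] : [/\ p \in V, q \in V & r \in V].
    by rewrite eV !inE !eqxx !orbT.
  have [X eX] := integral_pointP (intV _ pV).
  have [Y eY] := integral_pointP (intV _ qV).
  have [Z eZ] := integral_pointP (intV _ rV).
  have D (x y : 'rV[int]_3) : map_mx intr x \in V -> map_mx intr y \in V ->
      map_mx intr x != map_mx intr y :> 'rV[R]_3 ->
      dot (x - y) (x - y) = 2 * l%:Z ^+ 2.
    move=> xV yV ne; apply: (@intr_inj R).
    rewrite -dot_map map_mxB -edist_sqr (side _ _ xV yV ne) exprMn.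
    by rewrite sqr_sqrtr // rmorphM rmorphXn /= mulrC.
  have Z0 : map_mx intr (0 : 'rV[int]_3) = 0 :> 'rV[R]_3 by rewrite map_mx0.
  subst p q r; rewrite -Z0 in V0 op oq or_.
  have XX := D _ _ V0 pV op; have YY := D _ _ V0 qV oq.
  have ZZ := D _ _ V0 rV or_.
  have XY := D _ _ pV qV pq; have XZ := D _ _ pV rV pr.
  have YZ := D _ _ qV rV qr.
  have N (x : 'rV[int]_3) : dot (0 - x) (0 - x) = dot x x.
    by rewrite sub0r !dotE opprK.
  rewrite !N in XX YY ZZ.
  have [a [b [c [d [od [prim [dl [r [s [m [n [eps]]]]]]]]]]]] :=
    tetrahedron_parametrized l0 XX YY ZZ (dot_of_sides XX YY XY)
      (dot_of_sides XX ZZ XZ) (dot_of_sides YY ZZ YZ).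
  move=> [[adm om] seps eP eQ eR].
  exists a, b, c, d; do 3!split=> //; exists r, s, m, n, eps; split=> //.
  by rewrite eP eQ eR !to_space_int.
move=> a b c d r s prim adm k k0 m n om.
have [tau ht R3] := pointR_integral_mod3 prim adm om.
have {}ht : (3 %| tau - k%:Z)%Z || (3 %| tau + k%:Z)%Z.
  by move: ht; rewrite subr_sqr !dvdzE abszM Euclid_dvdM.
split=> [k3 eps _|k3]; first by apply/R3; lia.
case/orP: ht => ht; [exists 1 | exists (-1)];
  (split; first by split; [by [left | right] | apply/R3; lia]);
  move=> eps [[] -> /R3 he] //; lia.
Qed.
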